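(* Let $m,\ell$ be positive integers. Any periodic element in $G(m,\ell)$ is conjugate to a power of either $s(0,m)$ or $\Delta$. Moreover, the irreducible periodic elements of $G(m,\ell)$ are given, up to conjugacy, by \[\begin{cases} \{s(0,m)^{\pm 1}\}&\text{if }m\mid\ell,\\ \{\Delta^{\pm 1}\} &\text{if }\ell\mid m,\\ \{s(0,m)^{\pm 1},\Delta^{\pm 1}\}&\text{otherwise},\end{cases}\] that is, an element of $G(m,\ell)$ is an irreducible periodic element if and only if it is conjugate to an element of the indicated set.
   Context: For positive integers $m,\ell$, consider letters $a_0,\ldots,a_{m-1}$, and set $a_j:=a_{j'}$ for $j\in\mathbb{Z}$, where $j'\in\{0,\ldots,m-1\}$ and $j\equiv j' \pmod m$. For $i\in\mathbb{Z}$ and $p\geq 1$ let $s(i,p)=a_ia_{i+1}\cdots a_{i+p-1}$ (a product of $p$ consecutive letters). The circular group $G(m,\ell)$ is the group with generators $a_0,\ldots,a_{m-1}$ and relations $s(i,\ell)=s(i+1,\ell)$ for all $i\in\{0,\ldots,m-1\}$. The Garside element is $\Delta:=s(0,\ell)$, which equals $s(i,\ell)$ for every $i$ in $G(m,\ell)$. For integers $p,q$ with $p\neq 0$, an element $\rho\in G(m,\ell)$ is $(p,q)$-periodic if $\rho^p=\Delta^q$; it is periodic if it is $(p,q)$-periodic for some such $p,q$. A periodic element $\rho\neq 1$ is irreducible if it admits no roots in $G(m,\ell)$ other than itself, i.e. if $\sigma\in G(m,\ell)$ and $\sigma^n=\rho$ for some integer $n\geq 1$ imply $\sigma=\rho$.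 (When $m=\ell$, the first two cases coincide since $s(0,m)=\Delta$; if both $m\mid \ell$ and $\ell \mid m$ then $m=\ell$.) *)

(* Defs.v *)
From HB Require Import structures.
From mathcomp Require Import all_boot ssralg ssrint.
From mathcomp Require Import boolp.

Set Implicit Arguments.
Unset Strict Implicit.
Unset Printing Implicit Defensive.

Local Open Scope group_scope.

Section Presentation.

Variable T : choiceType.

(* [(x, false)] stands for the generator [x], [(x, true)] for its inverse. *)
Definition word := seq (T * bool).

Variable R : word -> word -> Prop.

(* The least congruence on words that contains [R] and free cancellation. *)
Inductive pres_eq : word -> word -> Prop :=
| pres_rel u v : R u v -> pres_eq u v
| pres_cancel x b : pres_eq [:: (x, b); (x, ~~ b)] [::]
| pres_cat u u' v v' : pres_eq u u' -> pres_eq v v' -> pres_eq (u ++ v) (u' ++ v')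
| pres_refl u : pres_eq u u
| pres_sym u v : pres_eq u v -> pres_eq v u
| pres_trans u v w : pres_eq u v -> pres_eq v w -> pres_eq u w.

Definition pres_eqb (u v : word) : bool := `[< pres_eq u v >].

Fact pres_eqb_refl : reflexive pres_eqb.
Proof. by move=> u; apply/asboolP/pres_refl. Qed.

Fact pres_eqb_sym : symmetric pres_eqb.
Proof. by move=> u v; apply/asboolP/asboolP => /pres_sym. Qed.

Fact pres_eqb_trans : transitive pres_eqb.
Proof.
by move=> v u w /asboolP uv /asboolP vw; apply/asboolP; apply: pres_trans vw.
Qed.

Canonical pres_equiv := EquivRel pres_eqb pres_eqb_refl pres_eqb_sym pres_eqb_trans.

Definition presented := {eq_quot pres_equiv}%qT.

HB.instance Definition _ := Choice.on presented.

Definition pres_class (w : word) : presented := (\pi_(presented) w)%qT.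

Lemma pres_classP u v : pres_class u = pres_class v <-> pres_eq u v.
Proof.
by split=> [/eqmodP /asboolP //|uv]; apply/eqmodP/asboolP.
Qed.

Lemma pres_class_repr (x : presented) : pres_class (repr x) = x.
Proof. exact: reprK. Qed.

Definition inv_word (w : word) : word := rev [seq (a.1, ~~ a.2) | a <- w].

Lemma inv_wordK : involutive inv_word.
Proof.
move=> w; rewrite /inv_word map_rev revK -map_comp -[RHS]map_id.
by apply: eq_map => -[x b] /=; rewrite negbK.
Qed.

Lemma inv_word_cat u v : inv_word (u ++ v) = inv_word v ++ inv_word u.
Proof. by rewrite /inv_word map_cat rev_cat. Qed.

Lemma cat_inv_word w : pres_eq (w ++ inv_word w) [::].
Proof.
elim: w => [|[x b] w IHw]; first exact: pres_refl.
rewrite -cat1s inv_word_cat.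
have -> : ([:: (x, b)] ++ w) ++ inv_word w ++ inv_word [:: (x, b)]
          = [:: (x, b)] ++ (w ++ inv_word w) ++ [:: (x, ~~ b)].
  by rewrite !catA.
apply: pres_trans (pres_cancel x b).
apply: (@pres_cat [:: (x, b)] [:: (x, b)] _ [:: (x, ~~ b)]).
  exact: pres_refl.
exact: (@pres_cat _ [::] _ _ IHw (pres_refl _)).
Qed.

Lemma inv_word_cat_self w : pres_eq (inv_word w ++ w) [::].
Proof. by have := cat_inv_word (inv_word w); rewrite inv_wordK. Qed.

Lemma pres_eq_inv u v : pres_eq u v -> pres_eq (inv_word u) (inv_word v).
Proof.
move=> uv; apply: (@pres_trans _ (inv_word u ++ v ++ inv_word v)).
  rewrite -{1}[inv_word u]cats0; apply: pres_cat; first exact: pres_refl.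
  exact/pres_sym/cat_inv_word.
rewrite catA -[X in pres_eq _ X]cat0s; apply: pres_cat; last exact: pres_refl.
apply: pres_trans (inv_word_cat_self u).
by apply: pres_cat; [exact: pres_refl | exact: pres_sym].
Qed.

Definition pres_one : presented := pres_class [::].
Definition pres_mul (x y : presented) : presented := pres_class (repr x ++ repr y).
Definition pres_inv (x : presented) : presented := pres_class (inv_word (repr x)).

Lemma pres_mulE u v :
  pres_mul (pres_class u) (pres_class v) = pres_class (u ++ v).
Proof.
by apply/pres_classP/pres_cat; apply/pres_classP; rewrite pres_class_repr.
Qed.

Lemma pres_invE u : pres_inv (pres_class u) = pres_class (inv_word u).
Proof. by apply/pres_classP/pres_eq_inv/pres_classP; rewrite pres_class_repr. Qed.

Fact pres_mulA : associative pres_mul.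
Proof.
move=> x y z; rewrite -[x]pres_class_repr -[y]pres_class_repr.
by rewrite -[z]pres_class_repr !pres_mulE catA.
Qed.

Fact pres_mul1 : left_id pres_one pres_mul.
Proof. by move=> x; rewrite -[x]pres_class_repr pres_mulE. Qed.

Fact pres_mulr1 : right_id pres_one pres_mul.
Proof. by move=> x; rewrite -[x]pres_class_repr pres_mulE cats0. Qed.

Fact pres_mulV : left_inverse pres_one pres_inv pres_mul.
Proof.
move=> x; rewrite -[x]pres_class_repr pres_invE pres_mulE.
exact/pres_classP/inv_word_cat_self.
Qed.

Fact pres_mulrV : right_inverse pres_one pres_inv pres_mul.
Proof.
move=> x; rewrite -[x]pres_class_repr pres_invE pres_mulE.
exact/pres_classP/cat_inv_word.
Qed.

HB.instance Definition _ := isGroup.Build presented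
  pres_mulA pres_mul1 pres_mulr1 pres_mulV pres_mulrV.

Definition pres_gen (x : T) : presented := pres_class [:: (x, false)].

Definition word_eval (H : groupType) (f : T -> H) (w : word) : H :=
  \prod_(a <- w) (if a.2 then (f a.1)^-1 else f a.1).

Lemma pres_universal (H : groupType) (f : T -> H) :
  (forall u v, R u v -> word_eval f u = word_eval f v) ->
  exists F : presented -> H,
    [/\ forall x y, F (x * y) = F x * F y & forall x, F (pres_gen x) = f x].
Proof.
move=> fR.
have E u v : pres_eq u v -> word_eval f u = word_eval f v.
  elim=> {u v} [//|x b|u u' v v' _ IHu _ IHv|//|//|u v w _ -> _ -> //].
    by rewrite /word_eval !big_cons big_nil mulg1 /=; case: b;
       rewrite /= ?mulVg ?mulgV.
  by rewrite /word_eval !big_cat /= -/(word_eval f u) -/(word_eval f v) IHu IHv.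
have EK w : word_eval f (repr (pres_class w)) = word_eval f w.
  by apply/E/pres_classP; rewrite pres_class_repr.
exists (fun x => word_eval f (repr x)); split=> [x y|x].
  by rewrite [LHS]EK /word_eval big_cat.
by rewrite EK /word_eval big_seq1.
Qed.

End Presentation.

(* The letters are indexed by ['I_m], on which [ordS] is the successor modulo
   [m]; hence [traject (@ordS m) i p] is [:: i; i + 1; ...; i + p - 1], with the
   indices taken modulo [m]. *)
Definition s_word (m : nat) (i : 'I_m) (p : nat) : word 'I_m :=
  [seq (j, false) | j <- traject (@ordS m) i p].

Definition circular_rel (m l : nat) (u v : word 'I_m) : Prop :=
  exists i : 'I_m, u = s_word i l /\ v = s_word (ordS i) l.

Definition circular (m l : nat) := presented (@circular_rel m l).
HB.instance Definition _ m l := Group.on (circular m l).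

Definition circ_a (m l : nat) (i : 'I_m) : circular m l :=
  pres_gen (@circular_rel m l) i.

Definition circ_s (m l : nat) (i : 'I_m) (p : nat) : circular m l :=
  \prod_(j <- traject (@ordS m) i p) circ_a l j.

Lemma circ_sE (m l : nat) (i : 'I_m) (p : nat) :
  circ_s l i p = pres_class (@circular_rel m l) (s_word i p).
Proof.
rewrite /circ_s /s_word; elim: (traject _ _ _) => [|j t IHt].
  by rewrite big_nil.
by rewrite big_cons IHt; apply: pres_mulE.
Qed.

Lemma circ_s_rel (m l : nat) (i : 'I_m) : circ_s l i l = circ_s l (ordS i) l.
Proof. by rewrite !circ_sE; apply/pres_classP/pres_rel; exists i. Qed.

(* The index [0] exists in ['I_m] only when [m] is positive. *)
Definition circ_Delta (m l : nat) (m_gt0 : 0 < m) : circular m l :=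
  circ_s l (Ordinal m_gt0) l.

Definition expgz (G : groupType) (x : G) (n : int) : G :=
  match n with
  | Posz k => x ^+ k
  | Negz k => x ^- k.+1
  end.

Definition conjugate (G : groupType) (x y : G) : Prop := exists g : G, y = x ^ g.

Definition pq_periodic (m l : nat) (m_gt0 : 0 < m) (p q : int)
    (rho : circular m l) : Prop :=
  expgz rho p = expgz (circ_Delta l m_gt0) q.

Definition periodic (m l : nat) (m_gt0 : 0 < m) (rho : circular m l) : Prop :=
  exists p q : int, p != 0%R /\ pq_periodic m_gt0 p q rho.

Definition irreducible_periodic (m l : nat) (m_gt0 : 0 < m)
    (rho : circular m l) : Prop :=
  [/\ periodic m_gt0 rho, rho <> 1 &
      forall (sigma : circular m l) (n : nat),
        0 < n -> sigma ^+ n = rho -> sigma = rho].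

(* Main.v *)
Require Import Defs.
From HB Require Import structures.
From mathcomp Require Import all_boot ssralg ssrint.
From mathcomp Require Import boolp.
From mathcomp Require Import zmodp.

Set Implicit Arguments.
Unset Strict Implicit.
Unset Printing Implicit Defensive.

Local Open Scope group_scope.

(** The Garside element [Delta] normalises everything: conjugating by it shifts
the indices of the letters by [l].  Hence every element can be written
[d * x_1 * ... * x_k] with [d] a power of [Delta] and each [x_r] a product
[s(i, p)] with [0 < p < l].  If [x_r = s(i, p)] and [x_(r+1) = s(i + p, q)] fit
together, they merge into the single product [s(i, p + q)], from which [Delta]
can be split off when [p + q >= l]; so such a pair shortens the expression
([factored_not_normal]).  The word is normal when it has no such pair.

Normal words are the normal forms of the cosets of the subgroup generated by
[Delta], and the group acts on them as it acts on these cosets ([act]): a letter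
is glued to the front of the word, and if this completes a [Delta], the [Delta]
moves to the right end, shifting the indices it passes, and is absorbed.  Powers
of [Delta] fix the empty word, while the product of a normal word [w] sends the
empty word to [w].

Take now a periodic element, with [k] minimal in its conjugacy class.  If
[k > 1], the word is normal and its last product, moved past [d], does not fit
with the first one, since otherwise conjugation would move it to the front and
allow a merge.  Then the normal words of the powers of the element are obtained
by juxtaposing shifted copies of its own, so that the powers move
the empty word to words of unbounded length
([cyclically_normal_not_power]), which is impossible for an element with a
power in the subgroup generated by [Delta].  So [k <= 1].  For [k = 0] the
element is a power of [Delta].  For [k = 1] the product moved past [d] must fit
with itself, by the same argument; then [d * s(i, p)] or its inverse is a product of consecutive letters whose
number is a multiple of [m], that is, a power of [s(j, m)]
([is_power_single]), and [s(j, m)] is conjugate to [s(0, m)].  This is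
[power_periodic_classification].

Irreducibility follows by counting letters, which defines a homomorphism [len]
to the integers with [len s(0, m) = m] and [len Delta = l].  A root of
[s(0, m)] is periodic, hence conjugate to a power of [s(0, m)] or of [Delta];
comparing lengths, an [n]-th root with [n > 1] forces [l] to be a proper divisor
of [m].  The same argument applies to [Delta]
([irreducible_of_length]). *)

(** * Conjugacy and integer powers *)

Section Conjugacy.

Variable G : groupType.
Implicit Types x y z : G.

Lemma conjugate_refl x : conjugate x x.
Proof. by exists 1; rewrite conjg1. Qed.

Lemma conjugate_trans x y z : conjugate x y -> conjugate y z -> conjugate x z.
Proof. by case=> g -> [h ->]; exists (g * h); rewrite conjgM. Qed.

Lemma conjugate_sym x y : conjugate x y -> conjugate y x.
Proof. by case=> g ->; exists g^-1; rewrite conjgK. Qed.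

Lemma conjugate_rot x y : conjugate (x * y) (y * x).
Proof. by exists x; rewrite conjgE -mulgA mulKg. Qed.

Lemma conjg_expgz x g n : expgz x n ^ g = expgz (x ^ g) n.
Proof. by case: n => n; rewrite /expgz ?conjVg conjXg. Qed.

Lemma conjugate_expgz x y n :
  conjugate x y -> conjugate (expgz x n) (expgz y n).
Proof. by case=> g ->; exists g; rewrite conjg_expgz. Qed.

Lemma expgzN x n : expgz x (- n)%R = (expgz x n)^-1.
Proof. by case: n => [[|n]|n]; rewrite /expgz ?expg0 ?invg1 ?invgK. Qed.

Lemma expgzE x n : exists k, expgz x n = x ^+ k \/ expgz x n = x ^- k.
Proof. by case: n => k; [exists k; left | exists k.+1; right]. Qed.

Definition is_power x y := exists n : int, y = expgz x n.

Lemma is_powerX x n : is_power x (x ^+ n). Proof. by exists (Posz n). Qed.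

Lemma is_power1 x : is_power x 1. Proof. exact: (is_powerX x 0). Qed.

Lemma is_power_refl x : is_power x x. Proof. exact: (is_powerX x 1). Qed.

Lemma is_powerV x y : is_power x y -> is_power x y^-1.
Proof. by case=> n ->; exists (- n)%R; rewrite expgzN. Qed.

Lemma is_powerM x y z : is_power x y -> is_power x z -> is_power x (y * z).
Proof.
have X_XV (a b : nat) : is_power x (x ^+ a * x ^- b).
  have [leba|/ltnW leab] := leqP b a.
    by rewrite -expgnFr //; exact: is_powerX.
  have -> : x ^+ a * x ^- b = (x ^+ (b - a))^-1.
    by rewrite expgnFr // invgM invgK.
  exact/is_powerV/is_powerX.
have XC a b : x ^- b * x ^+ a = x ^+ a * x ^- b.
  by apply: commute_sym; apply: commuteV; apply: commuteX2; apply: commute_refl.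
case=> a -> [b ->]; have [[p [->|->]] [q [->|->]]] := (expgzE x a, expgzE x b).
- by rewrite -expgnDr; apply: is_powerX.
- exact: X_XV.
- by rewrite XC; apply: X_XV.
- by rewrite -invgM -expgnDr; apply/is_powerV/is_powerX.
Qed.

Lemma is_power_trans x y z : is_power x y -> is_power y z -> is_power x z.
Proof.
have X k : is_power x y -> is_power x (y ^+ k).
  move=> xy; elim: k => [|k IHk]; first exact: is_power1.
  by rewrite expgS; apply: is_powerM.
move=> xy [n ->]; have [k [->|->]] := expgzE y n; first exact: X.
exact/is_powerV/X.
Qed.

End Conjugacy.

(** * Arithmetic of the letters *)

Section Letters.

Variables (n l : nat).
Local Notation m := n.+1.
Local Notation G := (circular m l).
Local Notation S := (@circ_s m l).
Local Notation "k %:I" := (@inZp n k) (at level 2, format "k %:I").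
Local Notation Delta := (S ord0 l).
Implicit Types (i j c : 'I_m) (p q k : nat).

Lemma ordS_add i : ordS i = (i + 1%:I)%R.
Proof. by apply: val_inj; rewrite /= modnDmr addn1. Qed.

Lemma inZpD p q : (p + q)%:I = (p%:I + q%:I)%R.
Proof. by apply: val_inj; rewrite /= modnDm. Qed.

Lemma inZp0 : 0%:I = 0%R.
Proof. by apply: val_inj; rewrite /= mod0n. Qed.

Lemma inZp_eq0 p : (p%:I == 0%R) = (m %| p).
Proof. by []. Qed.

Lemma circ_s0 i : S i 0 = 1.
Proof. by rewrite /circ_s big_nil. Qed.

Lemma circ_sS i p : S i p.+1 = circ_a l i * S (i + 1%:I)%R p.
Proof. by rewrite /circ_s trajectS big_cons ordS_add. Qed.

Lemma circ_s1 i : S i 1 = circ_a l i.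
Proof. by rewrite circ_sS circ_s0 mulg1. Qed.

Lemma circ_sD i p q : S i (p + q) = S i p * S (i + p%:I)%R q.
Proof.
elim: p i => [|p IHp] i; first by rewrite circ_s0 mul1g inZp0 GRing.addr0.
by rewrite addSn !circ_sS IHp -mulgA -[p.+1]add1n inZpD GRing.addrA.
Qed.

Lemma circ_s_Delta i : S i l = Delta.
Proof.
have E k : S k%:I l = Delta.
  elim: k => [|k <-]; first by rewrite inZp0.
  by rewrite -[k.+1]addn1 inZpD -ordS_add -circ_s_rel.
by rewrite -(valZpK i).
Qed.

(** Both sides spell [s(i, p + l)], with its factor [Delta] read off from the
last or from the first [l] letters. *)
Lemma circ_s_mulDelta i p : S i p * Delta = Delta * S (i + l%:I)%R p.
Proof.
rewrite -{1}(circ_s_Delta (i + p%:I)%R) -circ_sD addnC circ_sD.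
by rewrite circ_s_Delta.
Qed.

Lemma circ_s_Xl i k : S i (l * k) = Delta ^+ k.
Proof.
elim: k i => [|k IHk] i; first by rewrite muln0 circ_s0.
by rewrite mulnS circ_sD IHk circ_s_Delta expgS.
Qed.

Lemma circ_s_Xm i k : S i (m * k) = S i m ^+ k.
Proof.
elim: k i => [|k IHk] i; first by rewrite muln0 circ_s0.
rewrite mulnS circ_sD expgS -IHk.
by have /eqP -> : m%:I == 0%R; rewrite ?inZp_eq0 // GRing.addr0.
Qed.

(** The conjugator is [s(0, i)]: the word [s(0, m + i)] starts with [s(0, m)] and
ends with [s(i, m)]. *)
Lemma conjugate_circ_sm i : conjugate (S i m) (S ord0 m).
Proof.
suff E : S ord0 i * S i m = S ord0 m * S ord0 i.
  have := conjugate_rot (S ord0 i)^-1 (S ord0 i * S i m).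
  by rewrite mulKg E mulgK.
have {2}-> : i = (ord0 + i%:I)%R by rewrite GRing.add0r valZpK.
rewrite -circ_sD addnC circ_sD.
by have /eqP -> : m%:I == 0%R; rewrite ?inZp_eq0 // GRing.addr0.
Qed.

(** * Normal words *)

(** The pair [(i, p)] stands for the product [s(i, p)]. *)
Definition syll := ('I_m * nat)%type.
Implicit Types (x y : syll) (w z : seq syll).

Definition eval w : G := \prod_(x <- w) S x.1 x.2.
Definition proper x := 0 < x.2 < l.
Definition next x : 'I_m := (x.1 + x.2%:I)%R.
(** The word [w] does not start at index [j], so that a product ending just before
[j] cannot be merged with the first product of [w]. *)
Definition unmergeable j w := if w is y :: _ then y.1 != j else true.
Fixpoint normal w :=
  if w is x :: w' then unmergeable (next x) w' && normal w' else true.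
Definition shift c w := [seq ((x.1 + c)%R, x.2) | x <- w].

Lemma eval_nil : eval [::] = 1. Proof. by rewrite /eval big_nil. Qed.
Lemma eval_cons x w : eval (x :: w) = S x.1 x.2 * eval w.
Proof. by rewrite /eval big_cons. Qed.
Lemma eval_cat w z : eval (w ++ z) = eval w * eval z.
Proof. by rewrite /eval big_cat. Qed.

Lemma size_shift c w : size (shift c w) = size w. Proof. exact: size_map. Qed.
Lemma proper_shift c w : all proper (shift c w) = all proper w.
Proof. by elim: w => //= x w ->. Qed.
Lemma unmergeable_shift c j w :
  unmergeable (j + c)%R (shift c w) = unmergeable j w.
Proof. by case: w => //= x w; rewrite (inj_eq (GRing.addIr c)). Qed.
Lemma normal_shift c w : normal (shift c w) = normal w.
Proof.
elim: w => //= x w ->; congr (_ && _).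
by rewrite -(unmergeable_shift c (next x)) /next /= GRing.addrAC.
Qed.
Lemma shiftD c c' w : shift c (shift c' w) = shift (c' + c)%R w.
Proof.
by rewrite /shift -map_comp; apply: eq_map => x /=; rewrite GRing.addrA.
Qed.
Lemma shift0 w : shift 0%R w = w.
Proof. by rewrite /shift map_id_in // => -[i p] _; rewrite GRing.addr0. Qed.

Definition conj_shift (d : G) c := forall i p, S i p * d = d * S (i + c)%R p.

Lemma conj_shift1 : conj_shift 1 0%R.
Proof. by move=> i p; rewrite mulg1 mul1g GRing.addr0. Qed.

Lemma conj_shiftM d d' c c' :
  conj_shift d c -> conj_shift d' c' -> conj_shift (d * d') (c + c')%R.
Proof.
by move=> dc dc' i p; rewrite mulgA dc -mulgA dc' mulgA GRing.addrA.
Qed.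

Lemma conj_shiftV d c : conj_shift d c -> conj_shift d^-1 (- c)%R.
Proof.
move=> dc i p; apply: (mulgI d); rewrite mulVKg -{1}(GRing.subrK c i).
by rewrite mulgA -dc mulgK.
Qed.

Lemma conj_shift_DeltaX k : conj_shift (Delta ^+ k) (l * k)%:I.
Proof.
elim: k => [|k IHk]; first by rewrite muln0 inZp0; apply: conj_shift1.
rewrite expgS mulnS inZpD; apply: conj_shiftM IHk => i p.
exact: circ_s_mulDelta.
Qed.

(** The shift [c] is tied to the number of letters of [d], which is compared with
[m] when a single product remains. *)
Definition power_shift (d : G) c := exists k,
  (d = Delta ^+ k /\ c = (l * k)%:I) \/
  (d = Delta ^- k /\ c = (- (l * k)%:I)%R).

Lemma is_power_shift d : is_power Delta d -> exists c, power_shift d c.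
Proof.
case=> e ->; have [k [->|->]] := expgzE Delta e.
  by exists (l * k)%:I, k; left.
by exists (- (l * k)%:I)%R, k; right.
Qed.

Lemma power_shift_conj d c : power_shift d c -> conj_shift d c.
Proof.
case=> k [[-> ->]|[-> ->]]; first exact: conj_shift_DeltaX.
exact/conj_shiftV/conj_shift_DeltaX.
Qed.

Lemma eval_conj_shift d c w :
  conj_shift d c -> eval w * d = d * eval (shift c w).
Proof.
move=> dc; elim: w => [|x w IHw]; first by rewrite eval_nil mulg1 mul1g.
by rewrite /= !eval_cons -mulgA IHw mulgA dc mulgA.
Qed.

Definition factored (g : G) k :=
  exists d w, [/\ is_power Delta d, all proper w, size w <= k & g = d * eval w].

Lemma factored_le g k k' : k <= k' -> factored g k -> factored g k'.
Proof.
move=> lekk' [d [w [dD Pw sw ->]]].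
by exists d, w; split=> //; apply: leq_trans lekk'.
Qed.

Lemma factored_power d : is_power Delta d -> factored d 0.
Proof. by exists d, [::]; rewrite eval_nil mulg1. Qed.

Lemma factoredM g h k k' :
  factored g k -> factored h k' -> factored (g * h) (k + k').
Proof.
move=> [d [w [dD Pw sw ->]]] [d' [w' [d'D Pw' sw' ->]]].
have [c /power_shift_conj d'c] := is_power_shift d'D.
exists (d * d'), (shift c w ++ w'); split; first exact: is_powerM.
- by rewrite all_cat proper_shift Pw.
- by rewrite size_cat size_shift leq_add.
- by rewrite eval_cat mulgA -(mulgA d) (eval_conj_shift w d'c) !mulgA.
Qed.

Lemma factored_eval w : all proper w -> factored (eval w) (size w).
Proof. by exists 1, w; rewrite mul1g; split=> //; apply: is_power1. Qed.

Lemma factored_circ_s i p : p < 2 * l -> factored (S i p) 1.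
Proof.
have fact_lt j q : q < l -> factored (S j q) 1.
  case: q => [_|q ltql].
    by rewrite circ_s0; apply: factored_le (factored_power (is_power1 _)).
  have := @factored_eval [:: (j, q.+1)]; rewrite eval_cons eval_nil mulg1.
  by apply; rewrite /= /proper ltql.
move=> ltp; have [|lelp] := ltnP p l; first exact: fact_lt.
rewrite -(subnKC lelp) circ_sD circ_s_Delta -[1%N]add0n.
apply: factoredM; first by apply: factored_power; apply: is_power_refl.
by apply: fact_lt; rewrite ltn_subLR // addnn -mul2n.
Qed.

Lemma factored_merge x y :
  proper x -> proper y -> y.1 = next x -> factored (S x.1 x.2 * S y.1 y.2) 1.
Proof.
move=> /andP[_ ltx] /andP[_ lty] ->; rewrite -circ_sD; apply: factored_circ_s.
by rewrite mul2n -addnn -addnS leq_add // ltnW.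
Qed.

Lemma factored_not_normal w :
  all proper w -> ~~ normal w -> factored (eval w) (size w).-1.
Proof.
elim: w => //= x w IHw /andP[Px Pw]; rewrite negb_and eval_cons.
have [nw|nnw] := boolP (normal w); last first.
  have fw := IHw Pw nnw; have -> : size w = (1 + (size w).-1)%N.
    by case: w nnw {IHw Pw fw}.
  move=> _; apply: factoredM fw; apply: factored_circ_s.
  by case/andP: Px => _ ltx; rewrite mul2n -addnn ltn_addr.
rewrite orbF; case: w Pw {IHw nw} => //= y w /andP[Py Pw] /negPn/eqP yx.
rewrite eval_cons mulgA -[(size w).+1]add1n.
apply: factoredM; last exact: factored_eval.
exact: factored_merge.
Qed.

Hypothesis l_gt0 : 0 < l.

Lemma factored_gen i (b : bool) :
  factored (if b then (circ_a l i)^-1 else circ_a l i) 1.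
Proof.
have DP : is_power Delta Delta by apply: is_power_refl.
case: b; last first.
  rewrite -circ_s1; apply: factored_circ_s.
  by rewrite mul2n -addnn -addn1 leq_add.
(* [s(i, l) = Delta] starts with the letter [i]. *)
have -> : (circ_a l i)^-1 = S (i + 1%:I)%R l.-1 * Delta^-1.
  have <- : circ_a l i * S (i + 1%:I)%R l.-1 = Delta.
    by rewrite -circ_sS prednK // circ_s_Delta.
  by rewrite invgM mulVKg.
rewrite -[1%N]addn0; apply: factoredM; last exact/factored_power/is_powerV.
by apply: factored_circ_s; rewrite prednK // leq_pmull.
Qed.

Lemma factored_all (g : G) : exists k, factored g k.
Proof.
rewrite -(pres_class_repr g); elim: (repr g) => [|[i b] u [k fu]].
  by exists 0; apply: factored_power; apply: is_power1.
exists (1 + k)%N.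
have letterE : (if b then (circ_a l i)^-1 else circ_a l i)
    = pres_class (@circular_rel m l) [:: (i, b)].
  by case: b; first exact: pres_invE.
rewrite -cat1s -[pres_class _ _]pres_mulE -letterE.
by apply: factoredM fu; apply: factored_gen.
Qed.

(** * The action on normal words *)

(** The empty product [s(i, 0)] is not recorded in a word. *)
Definition cons0 i p w := if p is 0 then w else (i, p) :: w.
(** The length of the product at index [i] with which [w] starts, taken to be [0]
when there is none, and the rest of [w]. *)
Definition split_at i w : nat * seq syll :=
  if w is x :: w' then if x.1 == i then (x.2, w') else (0, w) else (0, w).

(** Gluing the letter [i] to the front of [w].  When this completes a [Delta], the
latter moves to the right end of the word, where it is absorbed by the coset. *)
Definition act_gen i w :=
  let: (p, w') := split_at (i + 1%:I)%R w in
  if p.+1 < l then (i, p.+1) :: w' else shift (- l%:I)%R w'.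

(** A letter that cannot be removed from the front is inverted through
[a_i^-1 = s(i + 1, l - 1) * Delta^-1]. *)
Definition act_inv i w :=
  let: (p, w') := split_at i w in
  if p is p'.+1 then cons0 (i + 1%:I)%R p' w'
  else ((i + 1%:I)%R, l.-1) :: shift l%:I w.

Fixpoint act_word (u : word 'I_m) w :=
  if u is (i, b) :: u' then
    (if b then act_inv i else act_gen i) (act_word u' w)
  else w.

Lemma act_word_cat u v w : act_word (u ++ v) w = act_word u (act_word v w).
Proof. by elim: u => //= -[i b] u ->. Qed.

Definition valid w := all proper w && normal w.

Lemma valid_shift c w : valid (shift c w) = valid w.
Proof. by rewrite /valid proper_shift normal_shift. Qed.

Lemma valid_cons x w :
  valid (x :: w) = [&& proper x, unmergeable (next x) w & valid w].
Proof. by rewrite /valid /= andbACA -andbA. Qed.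

Lemma split_at_unmergeable i w : unmergeable i w -> split_at i w = (0, w).
Proof. by case: w => //= x w /negbTE ->. Qed.

Lemma split_at_head i p w : split_at i ((i, p) :: w) = (p, w).
Proof. by rewrite /= eqxx. Qed.

Variant split_spec i w : Type :=
  | SplitUnmergeable of unmergeable i w
  | SplitHead p w' of w = (i, p) :: w'.

Lemma splitP i w : split_spec i w.
Proof.
case: w => [|[j p] w]; first by left.
by case: (eqVneq j i) => [->|neq]; [right with p w | left].
Qed.

Lemma act_gen_extend i p w :
  act_gen i (((i + 1%:I)%R, p) :: w) =
  if p.+1 < l then (i, p.+1) :: w else shift (- l%:I)%R w.
Proof. by rewrite /act_gen split_at_head. Qed.

Lemma act_gen_unmergeable i w :
  1 < l -> unmergeable (i + 1%:I)%R w -> act_gen i w = (i, 1%N) :: w.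
Proof. by move=> l1 fw; rewrite /act_gen split_at_unmergeable // l1. Qed.

Lemma act_inv_head i p w :
  act_inv i ((i, p.+1) :: w) = cons0 (i + 1%:I)%R p w.
Proof. by rewrite /act_inv split_at_head. Qed.

Lemma act_inv_unmergeable i w :
  unmergeable i w -> act_inv i w = ((i + 1%:I)%R, l.-1) :: shift l%:I w.
Proof. by move=> fw; rewrite /act_inv split_at_unmergeable. Qed.

(* When [l = 1] every element is a power of [Delta], and no product is proper. *)
Section LongDelta.
Hypothesis l_gt1 : 1 < l.

Lemma shiftK w : shift (- l%:I)%R (shift l%:I w) = w.
Proof. by rewrite shiftD GRing.subrr shift0. Qed.
Lemma shiftVK w : shift l%:I (shift (- l%:I)%R w) = w.
Proof. by rewrite shiftD GRing.addNr shift0. Qed.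

Lemma next_S i p : next (i, p.+1) = next ((i + 1%:I)%R, p).
Proof. by rewrite /next /= -[p.+1]add1n inZpD GRing.addrA. Qed.

Lemma next_gen i : (i + 1%:I)%R = next (i, 1%N). Proof. by []. Qed.

Lemma next_pred i : next ((i + 1%:I)%R, l.-1) = (i + l%:I)%R.
Proof. by rewrite -next_S prednK. Qed.

Lemma act_gen_valid i w : valid w -> valid (act_gen i w).
Proof.
case: (splitP (i + 1%:I)%R w) => [fw vw|p w' ->].
  by rewrite act_gen_unmergeable // valid_cons vw -next_gen fw /proper l_gt1.
rewrite valid_cons act_gen_extend => /and3P[/andP[p_gt0 _] fw vw].
case: ifP => [ltp|_]; last by rewrite valid_shift.
by rewrite valid_cons vw next_S fw /proper ltp.
Qed.

Lemma act_inv_valid i w : valid w -> valid (act_inv i w).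
Proof.
case: (splitP i w) => [fw vw|[|p] w' ->].
- rewrite act_inv_unmergeable // valid_cons valid_shift vw next_pred.
  rewrite unmergeable_shift fw /proper /= prednK // leqnn.
  by rewrite -ltnS prednK ?l_gt1.
- by rewrite valid_cons /proper.
rewrite valid_cons act_inv_head => /and3P[/andP[_ ltp] fw vw].
case: p ltp fw => //= p ltp fw.
by rewrite valid_cons vw -next_S fw /proper /= ltnW.
Qed.

Lemma act_genK i w : valid w -> act_inv i (act_gen i w) = w.
Proof.
case: (splitP (i + 1%:I)%R w) => [fw vw|p w' ->].
  by rewrite act_gen_unmergeable // act_inv_head.
rewrite valid_cons act_gen_extend => /and3P[/andP[p_gt0 ltp] fw vw].
case: ifP => [ltSp|leSp].
  by rewrite act_inv_head; case: p p_gt0 {ltp fw ltSp}.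
have El : p.+1 = l by apply/eqP; rewrite eqn_leq ltp leqNgt leSp.
rewrite act_inv_unmergeable ?shiftVK -?El //.
by rewrite El -[i](GRing.addrK l%:I) unmergeable_shift -next_pred -El.
Qed.

Lemma act_invK i w : valid w -> act_gen i (act_inv i w) = w.
Proof.
case: (splitP i w) => [fw vw|[|p] w' ->].
- by rewrite act_inv_unmergeable // act_gen_extend prednK // ltnn shiftK.
- by rewrite valid_cons /proper.
rewrite valid_cons act_inv_head => /and3P[/andP[_ ltp] fw vw].
case: p ltp fw => [|p] ltp fw; first by rewrite act_gen_unmergeable.
by rewrite /= act_gen_extend ltp.
Qed.

Lemma act_word_valid u w : valid w -> valid (act_word u w).
Proof.
move=> vw; elim: u => //= -[i []] u IHu; first exact: act_inv_valid.
exact: act_gen_valid.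
Qed.

Lemma act_s_word_extend i p q w : 0 < q -> p + q < l ->
  act_word (s_word i p) (((i + p%:I)%R, q) :: w) = (i, (p + q)%N) :: w.
Proof.
move=> q_gt0; elim: p i => [|p IHp] i ltpq /=.
  by rewrite inZp0 GRing.addr0.
rewrite -[X in (X, q)]/(next (i, p.+1)) next_S ordS_add.
by rewrite IHp 1?ltnW // act_gen_extend addSn ltpq.
Qed.

Lemma act_s_word_close i p q w : 0 < p -> 0 < q -> p + q = l ->
  act_word (s_word i p) (((i + p%:I)%R, q) :: w) = shift (- l%:I)%R w.
Proof.
case: p => // p _ q_gt0 Epq; rewrite /s_word /= ordS_add.
rewrite -[X in (X, q)]/(next (i, p.+1)) next_S.
rewrite act_s_word_extend // -?Epq ?addSn //.
by rewrite act_gen_extend -addSn Epq ltnn.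
Qed.

Lemma act_s_word_unmergeable i p w : 0 < p < l -> unmergeable (i + p%:I)%R w ->
  act_word (s_word i p) w = (i, p) :: w.
Proof.
case: p => // p ltp; rewrite /s_word trajectSr map_rcons -cats1 act_word_cat /=.
rewrite -/(s_word i p).
have -> : iter p (@ordS m) i = (i + p%:I)%R.
  elim: p {ltp} => [|p /= ->]; first by rewrite inZp0 GRing.addr0.
  by rewrite ordS_add -GRing.addrA -inZpD addn1.
move=> fw; rewrite act_gen_unmergeable // -?GRing.addrA -?inZpD ?addn1 //.
by rewrite act_s_word_extend // addn1.
Qed.

Lemma s_wordD i p q : s_word i (p + q) = s_word i p ++ s_word (i + p%:I)%R q.
Proof.
elim: p i => [|p IHp] i; first by rewrite inZp0 GRing.addr0.
by rewrite /s_word /= -/(s_word _ _) IHp ordS_add -[(_ + _ + _)%R]next_S.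
Qed.

(** This value does not depend on [i], so the defining relations are respected.
If [w] starts with [(i + l, p)], the last [l - p] letters of [s(i, l)] complete
that product to a [Delta], and the first [p] letters create a shifted copy
of it. *)
Lemma act_s_word_Delta i w :
  valid w -> act_word (s_word i l) w = shift (- l%:I)%R w.
Proof.
case: (splitP (i + l%:I)%R w) => [fw vw|p w' ->].
  have E1l : (1 + l.-1)%N = l by rewrite add1n prednK.
  rewrite -[l in s_word i l]E1l s_wordD act_word_cat.
  rewrite (@act_s_word_unmergeable _ l.-1) ?[(_ + _ + _)%R]next_pred //.
    by rewrite (@act_s_word_close i 1) // ?add1n ?prednK // -ltnS prednK.
  by rewrite prednK // leqnn andbT -ltnS prednK.
rewrite valid_cons /= => /and3P[/andP[/= p_gt0 ltp] fw vw].
have lpl : (p + (l - p))%N = l by rewrite subnKC // ltnW.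
rewrite -{1 2}lpl s_wordD act_word_cat inZpD GRing.addrA.
rewrite act_s_word_close ?subn_gt0 //; last by rewrite addnC.
rewrite act_s_word_unmergeable ?p_gt0 //=; first by rewrite GRing.addrK.
have -> : (i + p%:I = next ((i + l%:I)%R, p) - l%:I)%R.
  by rewrite /next /= GRing.addrAC GRing.addrK.
by rewrite unmergeable_shift.
Qed.

Lemma act_word_pres u v : pres_eq (@circular_rel m l) u v ->
  forall w, valid w -> act_word u w = act_word v w.
Proof.
elim=> {u v} [u v [i [-> ->]]|i b|u u' v v' _ IHu _ IHv|//|u v _ IH
             |u v w _ IHu _ IHv] z vz.
- by rewrite !act_s_word_Delta.
- by case: b; [apply: act_genK | apply: act_invK].
- by rewrite !act_word_cat IHv // IHu // act_word_valid.
- by rewrite IH.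
- by rewrite IHu // IHv.
Qed.

Definition act (g : G) w := act_word (repr g) w.

Lemma act_class u w :
  valid w -> act (pres_class (@circular_rel m l) u) w = act_word u w.
Proof. by apply: act_word_pres; apply/pres_classP; rewrite pres_class_repr. Qed.

Lemma actM g h w : valid w -> act (g * h) w = act g (act h w).
Proof. by move=> vw; rewrite act_class // act_word_cat. Qed.

Lemma act1 w : valid w -> act 1 w = w.
Proof. by move=> vw; rewrite act_class. Qed.

Lemma act_Delta w : valid w -> act Delta w = shift (- l%:I)%R w.
Proof. by move=> vw; rewrite circ_sE act_class // act_s_word_Delta. Qed.

Lemma act_circ_s x w : valid (x :: w) -> act (S x.1 x.2) w = x :: w.
Proof.
rewrite valid_cons => /and3P[Px fw vw].
by rewrite circ_sE act_class // act_s_word_unmergeable //; case: x {Px fw}.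
Qed.

Lemma act_eval w z : valid (w ++ z) -> act (eval w) z = w ++ z.
Proof.
elim: w => [|x w IHw] vwz; first by rewrite eval_nil act1.
have /and3P[_ _ vwz'] :
    [&& proper x, unmergeable (next x) (w ++ z) & valid (w ++ z)].
  by rewrite -valid_cons.
have vz : valid z.
  elim: w {IHw vwz} vwz' => //= y w IHw.
  by rewrite valid_cons => /and3P[_ _ /IHw].
by rewrite eval_cons actM // IHw // act_circ_s.
Qed.

Lemma act_power_shift d c w :
  power_shift d c -> valid w -> act d w = shift (- c)%R w.
Proof.
have actX k z : valid z -> act (Delta ^+ k) z = shift (- (l * k)%:I)%R z.
  elim: k z => [|k IHk] z vz.
    by rewrite muln0 inZp0 GRing.oppr0 shift0 act1.
  rewrite expgS actM // IHk // act_Delta ?valid_shift // shiftD -GRing.opprD.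
  by rewrite -inZpD -mulnSr.
case=> k [[-> ->]|[-> ->]] vw; first exact: actX.
rewrite GRing.opprK -{1}[w](shift0 w) -(GRing.subrr (l * k)%:I) -shiftD.
by rewrite -actX ?valid_shift // -actM ?valid_shift // mulVg act1 ?valid_shift.
Qed.

Lemma is_power_act_nil d : is_power Delta d -> act d [::] = [::].
Proof. by move=> /is_power_shift[c /act_power_shift ->]. Qed.

Lemma normal_cat y v z :
  normal ((y :: v) ++ z) =
  [&& normal (y :: v), unmergeable (next (last y v)) z & normal z].
Proof.
elim: v y => [|y' v IHv] y; first by [].
rewrite -[LHS]/(unmergeable (next y) (y' :: v) && normal ((y' :: v) ++ z)).
by rewrite IHv andbA.
Qed.

(** Each application of the element then puts a whole copy of the word in front of
any word that its last product does not merge with, and this class of words is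
preserved because [c] is the shift caused by [d]. *)
Lemma cyclically_normal_not_power d c y v k :
  power_shift d c -> valid (y :: v) ->
  y.1 != (next (last y v) + c)%R -> 0 < k ->
  ~ is_power Delta ((d * eval (y :: v)) ^+ k).
Proof.
move=> dc vw nyx k_gt0 /is_power_act_nil.
set w := y :: v; set g := d * eval w; set x := last y v.
have step z : valid z -> unmergeable (next x) z ->
    let z' := act g z in
    [/\ valid z', unmergeable (next x) z' & size z' = (size w + size z)%N].
  move=> vz fz; have vwz : valid (w ++ z).
    rewrite /valid all_cat normal_cat fz.
    by case/andP: vw => -> ->; case/andP: vz => -> ->.
  rewrite /g actM // act_eval // (act_power_shift dc) // size_shift size_cat.
  rewrite valid_shift vwz; split=> //.
  by rewrite -(GRing.addrK c (next x)) unmergeable_shift.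
have grow (j : nat) : let z := act (g ^+ j) [::] in
    [/\ valid z, unmergeable (next x) z & size z = (size w * j)%N].
  elim: j => [|j [vz fz sz]]; first by rewrite expg0 act1 // muln0.
  by rewrite expgS actM // mulnS -sz; apply: step.
case: (grow k) => _ _ /[swap] -> /esym/eqP.
by rewrite muln_eq0 eqn0Ngt [k == _]eqn0Ngt k_gt0.
Qed.

End LongDelta.

(** * Periodic elements *)

Definition central (g : G) := forall h : G, commute g h.

Lemma central_DeltaXm : central (Delta ^+ m).
Proof.
move=> g; have [k [d [w [[e ->] _ _ ->]]]] := factored_all g.
apply: commuteM.
  have [q [->|->]] := expgzE Delta e; last apply: commuteV.
    by apply: commuteX2; apply: commute_refl.
  by apply: commuteX2; apply: commute_refl.
have := eval_conj_shift w (conj_shift_DeltaX m).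
have /eqP -> : (l * m)%:I == 0%R by rewrite inZp_eq0 dvdn_mull.
by rewrite shift0.
Qed.

(** A conjugate of a power of [Delta] need not be a power of [Delta]; with a central
power, invariance under conjugation is immediate. *)
Definition power_periodic (g : G) :=
  exists p, [/\ 0 < p, is_power Delta (g ^+ p) & central (g ^+ p)].

Lemma power_periodic_conj g h :
  conjugate g h -> power_periodic g -> power_periodic h.
Proof.
move=> [a ->] [p [p_gt0 gD gC]]; exists p.
by rewrite -conjXg conjgE gC mulKg.
Qed.

(** The equation for [i] says that the number of letters of [d * s(i, p)], counted
with [l] for each factor [Delta] of [d], is a multiple of [m]. *)
Lemma is_power_single d c i p :
  power_shift d c -> p < l -> i = (next (i, p) + c)%R ->
  exists j, is_power (S j m) (d * S i p).
Proof.
have pow j q : q%:I = 0%R -> is_power (S j m) (S j q).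
  move=> /eqP; rewrite inZp_eq0 => /dvdnP[e ->].
  by rewrite mulnC circ_s_Xm; apply: is_powerX.
have pos k : i = (next (i, p) + (l * k)%:I)%R ->
    exists j, is_power (S j m) (Delta ^+ k * S i p).
  move=> Ei; exists (i - (l * k)%:I)%R.
  rewrite -(circ_s_Xl (i - (l * k)%:I)%R) -{3}(GRing.subrK (l * k)%:I i).
  rewrite -circ_sD.
  apply: pow; apply: (GRing.addrI i); rewrite GRing.addr0 addnC inZpD GRing.addrA.
  exact: esym.
case=> k [[-> ->]|[-> ->]] ltp Ei; first exact: pos.
case: k Ei => [|k] Ei.
  rewrite expg0 invg1 -(expg0 Delta); apply: pos.
  by rewrite {1}Ei muln0 inZp0 GRing.oppr0.
(* The inverse is positive, as [Delta ^+ k.+1] starts with [s(i, p)]. *)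
have lepk : p <= l * k.+1 by rewrite (leq_trans (ltnW ltp)) // leq_pmulr.
exists (next (i, p)); rewrite -[_ * _]invgK; apply: is_powerV.
rewrite invgM invgK -(circ_s_Xl i) -{1}(subnKC lepk) circ_sD mulKg.
apply: pow; apply: (GRing.addrI p%:I); rewrite -inZpD subnKC // GRing.addr0.
by apply: (GRing.addrI i); rewrite {1}Ei GRing.subrK.
Qed.

Lemma power_periodic_classification g : power_periodic g ->
  exists e : int,
    conjugate g (expgz (S ord0 m) e) \/ conjugate g (expgz Delta e).
Proof.
have [k fg] := factored_all g.
elim: k g fg => [|k IHk] g [d [w [dD Pw sw Eg]]] Pg.
  case: w sw Eg {Pw} => // _ ->; rewrite eval_nil mulg1.
  by case: dD => e ->; exists e; right; apply: conjugate_refl.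
have [nw|nnw] := boolP (normal w); last first.
  apply: IHk Pg; apply: (@factored_le _ (0 + (size w).-1)); last first.
    rewrite Eg; apply: factoredM; first exact: factored_power.
    exact: factored_not_normal.
  by case: (size w) sw.
case: w Pw nw sw Eg => [|y v] Pw nw sw Eg.
  case: dD Eg => e ->; rewrite eval_nil mulg1 => ->.
  by exists e; right; apply: conjugate_refl.
have [c dc] := is_power_shift dD.
have [Ey|nyx] := eqVneq y.1 (next (last y v) + c)%R; last first.
  case: Pg => p [p_gt0 gD _].
  case: (@cyclically_normal_not_power _ d c y v p) => //.
  - by case/andP: Pw => /andP[y_gt0 lty] _; apply: leq_ltn_trans lty.
  - exact/andP.
  - by rewrite -Eg.
case: (lastP v) Pw nw sw Eg Ey => [|u x] Pw nw sw Eg Ey.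
  have [|j] := is_power_single dc _ Ey; first by case/andP: Pw => /andP[].
  rewrite -[_ * _]/(d * S y.1 y.2).
  have -> : d * S y.1 y.2 = g by rewrite Eg eval_cons eval_nil mulg1.
  by case=> e ->; exists e; left; apply/conjugate_expgz/conjugate_circ_sm.
(* The last product moves to the front, where it merges with [y]. *)
pose g' := d * eval (((x.1 + c)%R, x.2) :: y :: u).
have gg' : conjugate g g'.
  have -> : g' = S x.1 x.2 * (d * eval (y :: u)).
    by rewrite /g' !eval_cons !mulgA (power_shift_conj dc).
  rewrite Eg -rcons_cons -cats1 eval_cat (eval_cons x) eval_nil mulg1 mulgA.
  exact: conjugate_rot.
have [|e He] := IHk g' _ (power_periodic_conj gg' Pg); last first.
  by exists e; case: He => He; [left | right]; apply: conjugate_trans gg' He.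
apply: (@factored_le _ (0 + (size (y :: rcons u x)).-1)) => //.
apply: factoredM; first exact: factored_power.
have -> : size (y :: rcons u x) = size (((x.1 + c)%R, x.2) :: y :: u).
  by rewrite /= size_rcons.
apply: factored_not_normal.
  move: Pw; rewrite -rcons_cons all_rcons => /andP[Px Pyu].
  by apply/andP.
by rewrite /= Ey last_rcons /next GRing.addrAC eqxx.
Qed.

Lemma periodicP g : periodic (ltn0Sn n) g <-> power_periodic g.
Proof.
split=> [[p [q [p_neq0 Egq]]]|[p [p_gt0 [q Eq] _]]]; last first.
  by exists (Posz p), q; split=> //; rewrite -lt0n.
have [k k_gt0 [q' Eq']] :
    exists2 k, 0 < k & exists e : int, g ^+ k = expgz Delta e.
  case: p p_neq0 Egq => p p0 Eg.
    by exists p; [rewrite lt0n | exists q].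
  by exists p.+1 => //; exists (- q)%R; rewrite expgzN -[expgz Delta q]Eg invgK.
(* The factor [m] makes the power central. *)
exists (k * m)%N; rewrite muln_gt0 k_gt0 expgnA Eq'.
have [j [->|->]] := expgzE Delta q'.
  rewrite expgnAC; split=> //.
    by rewrite -expgnA; apply: is_powerX.
  by move=> h; apply/commute_sym/commuteX/commute_sym/central_DeltaXm.
rewrite -expVgn expgnAC expVgn expVgn; split=> //.
  by rewrite -expgnA; apply/is_powerV/is_powerX.
by move=> h; apply/commute_sym/commuteV/commuteX/commute_sym/central_DeltaXm.
Qed.

(** * Length *)

Definition word_len (u : word 'I_m) : int :=
  (\sum_(a <- u) (if a.2 then -1 else 1))%R.

Lemma word_len_pres u v :
  pres_eq (@circular_rel m l) u v -> word_len u = word_len v.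
Proof.
have lenS i p : word_len (s_word i p) = (p%:R)%R.
  rewrite /word_len /s_word big_map /= big_const_seq GRing.iter_addr_0.
  by rewrite count_predT size_traject.
elim=> {u v} [u v [i [-> ->]]|i b|u u' v v' _ IHu _ IHv|//|u v _ IH
             |u v w _ IHu _ IHv].
- by rewrite !lenS.
- by rewrite /word_len !big_cons big_nil; case: b.
- by rewrite /word_len !big_cat /= -!/(word_len _) IHu IHv.
- by rewrite IH.
- by rewrite IHu IHv.
Qed.

Definition len (g : G) : int := word_len (repr g).

Lemma len_class u : len (pres_class (@circular_rel m l) u) = word_len u.
Proof. by apply: word_len_pres; apply/pres_classP; rewrite pres_class_repr. Qed.

Lemma lenM g h : len (g * h) = (len g + len h)%R.
Proof. by rewrite [LHS]len_class /word_len big_cat. Qed.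

Lemma len1 : len 1 = 0%R.
Proof. by rewrite [LHS]len_class /word_len big_nil. Qed.

Lemma lenV g : len g^-1 = (- len g)%R.
Proof.
by apply: (GRing.addrI (len g)); rewrite -lenM mulgV len1 GRing.subrr.
Qed.

Lemma lenX g k : len (g ^+ k) = (k%:Z * len g)%R.
Proof.
elim: k => [|k IHk]; first by rewrite expg0 len1 GRing.mul0r.
by rewrite expgS lenM IHk intS GRing.mulrDl GRing.mul1r.
Qed.

Lemma len_expgz g e : len (expgz g e) = (e * len g)%R.
Proof. by case: e => k; rewrite /expgz ?lenV lenX // NegzE GRing.mulNr. Qed.

Lemma len_conjugate g h : conjugate g h -> len g = len h.
Proof.
by case=> a ->; rewrite conjgE !lenM lenV GRing.addrCA GRing.addNr GRing.addr0.
Qed.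

Lemma len_circ_s i p : len (S i p) = (p%:Z)%R.
Proof.
elim: p i => [|p IHp] i; first by rewrite circ_s0 len1.
rewrite circ_sS lenM IHp intS; congr (_ + _)%R.
by rewrite [LHS]len_class /word_len big_seq1.
Qed.

End Letters.

(** * Irreducible periodic elements *)

Section Irreducible.

Variables (n l : nat).
Hypothesis l_gt0 : 0 < l.
Local Notation m := n.+1.
Local Notation G := (circular m l).
Local Notation s := (circ_s l (@ord0 n) m).
Local Notation Delta := (circ_s l (@ord0 n) l).
Local Notation irreducible := (irreducible_periodic (ltn0Sn n)).
Implicit Types (x rho sigma : G).

Lemma periodic_conj rho tau : conjugate rho tau ->
  periodic (ltn0Sn n) rho -> periodic (ltn0Sn n) tau.
Proof.
move=> c /(periodicP l_gt0) P; apply/(periodicP l_gt0).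
exact: power_periodic_conj c P.
Qed.

Lemma periodicX k sigma : 0 < k ->
  periodic (ltn0Sn n) (sigma ^+ k) -> periodic (ltn0Sn n) sigma.
Proof.
move=> k_gt0 /(periodicP l_gt0)[p [p_gt0]]; rewrite -expgnA => D C.
by apply/(periodicP l_gt0); exists (k * p)%N; rewrite muln_gt0 k_gt0.
Qed.

Lemma periodicV rho : periodic (ltn0Sn n) rho -> periodic (ltn0Sn n) rho^-1.
Proof.
move=> /(periodicP l_gt0)[p [p_gt0 D C]]; apply/(periodicP l_gt0).
exists p; rewrite expVgn; split=> //; first exact: is_powerV.
by move=> h; apply/commute_sym/commuteV/commute_sym/C.
Qed.

Lemma irreducible_conj rho tau : conjugate rho tau ->
  irreducible rho -> irreducible tau.
Proof.
move=> c [Pr r1 rirr]; split; first exact: periodic_conj c Pr.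
  by case: c => g -> /eqP; rewrite conjg_eq1 => /eqP.
move=> sigma k k_gt0 Es; case: c Es => g -> Es.
by rewrite -(conjgKV g sigma) (rirr (sigma ^ g^-1) k) // -conjXg Es conjgK.
Qed.

Lemma irreducibleV rho : irreducible rho -> irreducible rho^-1.
Proof.
case=> Pr r1 rirr; split; first exact: periodicV.
  by move=> /eqP; rewrite invg_eq1 => /eqP.
move=> sigma k k_gt0 Es; apply: invg_inj; rewrite invgK.
by apply: (rirr _ k) => //; rewrite expVgn Es invgK.
Qed.

Lemma periodic_Delta : periodic (ltn0Sn n) Delta.
Proof. by exists 1%Z, 1%Z. Qed.

Lemma periodic_s : periodic (ltn0Sn n) s.
Proof.
exists (Posz l), (Posz m); split; first by rewrite -lt0n.
by rewrite /pq_periodic /expgz -circ_s_Xm mulnC circ_s_Xl.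
Qed.

(** The length of a [k]-th root is [e * b], with [b] the length of an element of
which it is, up to conjugacy, a power; the hypothesis excludes that [b] is a
proper divisor of [a]. *)
Lemma length_root (a b k : nat) (e : int) : 0 < a -> (b %| a -> a %| b) ->
  (k%:Z * (e * b%:Z) = a%:Z)%R -> k = 1%N.
Proof.
move=> a_gt0 ba /(congr1 absz); rewrite !abszM /= => E.
have Eab : b = a.
  have dba : b %| a by rewrite -E mulnA dvdn_mull.
  by apply/eqP; rewrite eqn_dvd dba ba.
have /eqP : (k * `|e|)%N = 1%N.
  by apply/eqP; rewrite -(eqn_pmul2r a_gt0) mul1n -mulnA -{1}Eab E.
by rewrite muln_eq1 => /andP[/eqP].
Qed.

Lemma irreducible_of_length x a :
  periodic (ltn0Sn n) x -> len x = (a%:Z)%R -> 0 < a ->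
  (m %| a -> a %| m) -> (l %| a -> a %| l) -> irreducible x.
Proof.
move=> Px Ex a_gt0 ma la; split=> //.
  by move=> x1; move: a_gt0; rewrite -ltz_nat -Ex x1 len1.
move=> sigma k k_gt0 Es.
suff k1 : k = 1%N by rewrite -Es k1 expg1.
have Ps : periodic (ltn0Sn n) sigma by apply: periodicX k_gt0 _; rewrite Es.
have Elen : (k%:Z * len sigma = a%:Z)%R by rewrite -lenX Es.
have /(periodicP l_gt0) := Ps => /(power_periodic_classification l_gt0)[e].
by case=> /len_conjugate Ee; move: Elen; rewrite Ee len_expgz len_circ_s;
   [apply: length_root a_gt0 ma | apply: length_root a_gt0 la].
Qed.

(** An element [z ^+ k.+1] without other roots equals [z]; here [z] is a conjugate
of [x] or of its inverse. *)
Lemma irreducible_power x rho :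
  (exists2 y, is_power x y & conjugate rho y) -> irreducible rho ->
  conjugate rho x \/ conjugate rho x^-1.
Proof.
case=> _ [e ->] /conjugate_sym[g Eg] [_ r1 rirr].
move: Eg; rewrite conjg_expgz; case: e => [[|k]|k] Eg.
- by case: r1.
- by left; apply: conjugate_sym; exists g; rewrite (rirr (x ^ g) k.+1).
right; apply: conjugate_sym; exists g.
by rewrite (rirr (x^-1 ^ g) k.+1) // conjVg expVgn.
Qed.

End Irreducible.

Theorem proposition2p13 (m l : nat) (m_gt0 : 0 < m) (l_gt0 : 0 < l) :
  let s : circular m l := circ_s l (Ordinal m_gt0) m in
  let Delta : circular m l := circ_Delta l m_gt0 in
  (forall rho : circular m l, periodic m_gt0 rho ->
     exists n : int, conjugate rho (expgz s n) \/ conjugate rho (expgz Delta n))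
  /\
  (forall rho : circular m l,
     irreducible_periodic m_gt0 rho <->
     exists2 tau : circular m l,
       tau \in (if m %| l then [:: s; s^-1]
                else if l %| m then [:: Delta; Delta^-1]
                else [:: s; s^-1; Delta; Delta^-1])
       & conjugate rho tau).
Proof.
case: m m_gt0 => // n m_gt0; rewrite (bool_irrelevance m_gt0 (ltn0Sn n)) {m_gt0}.
move=> s Delta.
have classify rho : periodic (ltn0Sn n) rho ->
    exists e : int, conjugate rho (expgz s e) \/ conjugate rho (expgz Delta e).
  by move/(periodicP l_gt0); apply: power_periodic_classification.
split=> // rho.
have irr_s : (l %| n.+1 -> n.+1 %| l) -> irreducible_periodic (ltn0Sn n) s.
  move=> lm; exact: (irreducible_of_length l_gt0 (@periodic_s n l l_gt0)
                       (@len_circ_s n l ord0 n.+1) isT id lm).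
have irr_Delta : (n.+1 %| l -> l %| n.+1) ->
    irreducible_periodic (ltn0Sn n) Delta.
  move=> ml; exact: (irreducible_of_length l_gt0 (@periodic_Delta n l)
                       (@len_circ_s n l ord0 l) l_gt0 ml id).
have irr_up x tau : irreducible_periodic (ltn0Sn n) x ->
    tau = x \/ tau = x^-1 -> conjugate rho tau ->
    irreducible_periodic (ltn0Sn n) rho.
  move=> irrx Etau /conjugate_sym c; apply: (irreducible_conj l_gt0 c).
  by case: Etau => ->; [|apply: irreducibleV].
split=> [irr|[tau]]; last first.
  case: ifP => [ml|ml]; last case: ifP => [lm|lm].
  - rewrite !inE => /orP Etau; apply: (irr_up s); first exact: irr_s.
    by case: Etau => /eqP; [left | right].
  - rewrite !inE => /orP Etau; apply: (irr_up Delta); first exact: irr_Delta.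
    by case: Etau => /eqP; [left | right].
  rewrite !inE => /or4P Etau.
  have [] : (tau = s \/ tau = s^-1) \/ (tau = Delta \/ tau = Delta^-1).
    by case: Etau => /eqP ->; auto.
  - by apply: irr_up; apply: irr_s; rewrite lm.
  by apply: irr_up; apply: irr_Delta; rewrite ml.
have [e He] := classify rho (let: And3 P _ _ := irr in P).
have in_s : (exists2 y, is_power s y & conjugate rho y) ->
    exists2 tau, tau \in [:: s; s^-1] & conjugate rho tau.
  move=> Hs; case: (irreducible_power Hs irr) => c.
    by exists s => //; rewrite inE eqxx.
  by exists s^-1 => //; rewrite !inE eqxx orbT.
have in_Delta : (exists2 y, is_power Delta y & conjugate rho y) ->
    exists2 tau, tau \in [:: Delta; Delta^-1] & conjugate rho tau.
  move=> Hs; case: (irreducible_power Hs irr) => c.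
    by exists Delta => //; rewrite inE eqxx.
  by exists Delta^-1 => //; rewrite !inE eqxx orbT.
case: ifP => [/dvdnP[k El]|ml]; last case: ifP => [/dvdnP[k Em]|lm].
- apply: in_s; case: He => c; [exists (expgz s e) | exists (expgz Delta e)] => //.
    by exists e.
  apply: is_power_trans; last by exists e.
  have -> : Delta = s ^+ k by rewrite -circ_s_Xm mulnC -El.
  exact: is_powerX.
- apply: in_Delta; case: He => c; [exists (expgz s e) | exists (expgz Delta e)] => //;
    last by exists e.
  apply: is_power_trans; last by exists e.
  have -> : s = Delta ^+ k by rewrite -[RHS](@circ_s_Xl n l ord0 k) mulnC -Em.
  exact: is_powerX.
case: He => c.
  have [|tau tau_in c'] := in_s; first by exists (expgz s e) => //; exists e.
  by exists tau => //; move: tau_in; rewrite !inE => /orP[->|->]; rewrite ?orbT.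
have [|tau tau_in c'] := in_Delta.
  by exists (expgz Delta e) => //; exists e.
by exists tau => //; move: tau_in; rewrite !inE => /orP[->|->]; rewrite ?orbT.
Qed.
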